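(* Let $(X,d)$ be a metric space such that every self-mapping $T:X\to X$ satisfying $$d(Tx,Ty)<\frac{1}{2}\{d(x,Tx)+d(y,Ty)\}\quad\text{for all } x,y\in X \text{ with } x\neq y$$ has a unique fixed point. Then $(X,d)$ is a complete metric space. *)

(* Defs.v *)
From mathcomp Require Import all_boot all_order all_algebra.
From mathcomp Require Import all_classical all_reals all_analysis.

Set Implicit Arguments.
Unset Strict Implicit.
Unset Printing Implicit Defensive.

Local Open Scope classical_set_scope.
Local Open Scope ring_scope.

(* Sequential completeness. The library's [completeType] cannot be used here:
   it is a structure rather than a predicate, and it requires a chosen point,
   whereas [metricType] also allows the empty space. *)
Definition complete_metric (R : realType) (X : metricType R) : Prop :=
  forall u : nat -> X, cauchy (u @ \oo) -> exists l : X, u @ \oo --> l.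

(* Main.v *)
Require Import Defs.
From mathcomp Require Import all_boot all_order all_algebra.
From mathcomp Require Import all_classical all_reals all_analysis.
From mathcomp Require Import lra.

Import Order.TTheory GRing.Theory Num.Theory.

Local Open Scope ring_scope.

(** Suppose a Cauchy sequence [u] has no limit. For each [x], the distances
    [d(x, u_n)] stay away from [0] whereas the tail of [u] after [n] gets
    arbitrarily small, so some index [n = f x] has its whole tail within
    [d(x, u_n) / 2] of [u_n]. Then [T x := u_(f x)] has no fixed point, and when
    [f x <= f y], the point [T y] lies in the tail after [f x], so that
    [d(Tx, Ty) < d(x, Tx) / 2]: [T] is a contraction in the required sense. *)

Lemma cauchy_seq_mdist {R : realType} {X : metricType R} {u : nat -> X} {e : R} :
  (cauchy (u @ \oo))%classic -> 0 < e ->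
  exists N : nat, forall m n, (N <= m)%N -> (N <= n)%N -> mdist (u m) (u n) < e.
Proof.
move=> /cauchy_ballP cu e0; have := cu _ e0; rewrite near_map2.
move=> [[A B] /= [[M _ AM] [N _ BN]] ABe]; exists (maxn M N) => m n.
rewrite !geq_max => /andP[Mm _] /andP[_ Nn].
by have := ABe (m, n) (conj (AM _ Mm) (BN _ Nn)); rewrite /= ballEmdist.
Qed.

(** Otherwise every [n] has some [m >= n] with [d(x, u_n) <= 2 d(u_n, u_m)], and the Cauchy property
    then forces [u] to converge to [x]. *)
Lemma cauchy_tail_mdist {R : realType} {X : metricType R} {u : nat -> X} {x : X} :
  (cauchy (u @ \oo))%classic -> ~ (u @ \oo --> x)%classic ->
  exists n : nat, forall m, (n <= m)%N ->
    mdist (u n) (u m) < 1 / 2 * mdist x (u n).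
Proof.
move=> cu ux; apply: contrapT => /forallNP notail; apply: ux.
apply/metricType_numDomainType.cvgrPdist_lt => e e0.
(* The bound [e / 2] compensates the factor 2 in [d(x, u_n) <= 2 d(u_n, u_m)]. *)
have [N uN] := cauchy_seq_mdist cu (divr_gt0 e0 (ltr0n _ 2)).
exists N => // n /= Nn.
have /existsNP[m /not_implyP[nm /negP]] := notail n.
rewrite -leNgt => h.
have := uN _ _ Nn (leq_trans Nn nm); lra.
Qed.

Theorem theorem2p5 (R : realType) (X : metricType R)
    (hfix : forall T : X -> X,
      (forall x y : X, x <> y ->
         mdist (T x) (T y) < 1 / 2 * (mdist x (T x) + mdist y (T y))) ->
      exists! x : X, T x = x) :
  complete_metric X.
Proof.
move=> u cu; apply: contrapT => /forallNP ulim.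
have [f fP] := choice (fun x => cauchy_tail_mdist cu (ulim x)).
have Tlt x y : (f x <= f y)%N ->
    mdist (u (f x)) (u (f y)) < 1 / 2 * (mdist x (u (f x)) + mdist y (u (f y))).
  by move=> /fP; have := mdist_ge0 y (u (f y)); lra.
have [x y _|x [Tx _]] := hfix (u \o f).
  (* Both sides are symmetric in [x] and [y], so [Tlt] covers either order of [f x] and [f y]. *)
  by have [/Tlt//|/ltnW/Tlt] := leqP (f x) (f y); rewrite metric_sym addrC.
(* At a fixed point [x], the tail bound taken at index [f x] itself reads [0 < 0]. *)
by have := fP x _ (leqnn _); rewrite [u (f x)]Tx mdistxx mulr0 ltxx.
Qed.
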